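(* Let $X$ and $Y$ be Banach spaces and let $\Omega$ be a compact Hausdorff space with Borel $\sigma$-algebra $\Sigma$. Let $1\le p\le\infty$. Assume that $m:\Sigma\to\mathcal{L}(X,Y^{**})$ is a representing measure of $U\in\mathcal{L}(\mathcal{C}_p(\Omega,X),Y)$. Then $m$ is the representing measure of the associated operator $U^{\#}\in\mathcal{L}(\mathcal{C}(\Omega),\mathcal{L}(X,Y))$, $(U^{\#}\varphi)x=U(\varphi x)$.
   Context: Banach spaces are over the same field $\mathbb{K}$ ($\mathbb{R}$ or $\mathbb{C}$) and are regarded as subspaces of their biduals; $\mathcal{L}$ denotes bounded linear operators and $B_Z$ the closed unit ball of $Z$. $p'$ is the conjugate index of $p$ ($1/p+1/p'=1$, $1/\infty=0$). $\mathcal{C}(\Omega)$, $\mathcal{C}(\Omega,X)$ are the spaces of continuous scalar-, resp. $X$-valued functions. $\mathcal{B}(\Sigma)$ is the Banach space of uniform limits of sequences of $\Sigma$-simple scalar functions. $\mathcal{C}_p(\Omega,X)$ consists of all $f\in\mathcal{C}(\Omega,X)$ for which there is $(x_n)\in\ell_p(X)$ (absolutely $p$-summable; $(x_n)\in c_0(X)$ if $p=\infty$) with $f(\Omega)\subset\{\sum_n\alpha_nx_n:(\alpha_n)\in B_{\ell_{p'}}\}$, with norm the infimum of $\|(x_n)\|_p$ over such sequences. It is a Banach space, in which the linear span of the functions $\varphi x$ ($\varphi\in\mathcal{C}(\Omega)$, $x\in X$) is dense, and $\mathcal{C}_p(\Omega,X)^*=\mathcal{P}_{p'}(\mathcal{C}(\Omega),X^*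 )$ isometrically under $\langle\varphi x,T\rangle=\langle x,T\varphi\rangle$, where $\mathcal{P}_q$ is the ideal of absolutely $q$-summing operators with its norm ($\mathcal{P}_\infty=\mathcal{L}$; $\|T\|_{\mathcal{P}_q}=\infty$ if $T\notin\mathcal{P}_q$). A vector measure is a finitely additive set function; it is bounded if its range is bounded. For bounded $m$, $\int_\Omega\varphi\,dm$ is defined for $\varphi\in\mathcal{B}(\Sigma)$ by $\int_\Omega\chi_E\,dm=m(E)$, linearity, and density. For bounded $m:\Sigma\to\mathcal{L}(X,Y^{**})$ and $y^*\in Y^*$, $m_{y^*}:\Sigma\to X^*$ is given by $\langle x,m_{y^*}(E)\rangle=\langle y^*,m(E)x\rangle$, and $I_{y^*}\in\mathcal{L}(\mathcal{C}(\Omega),X^* )$ is $I_{y^*}\varphi=\int_\Omega\varphi\,dm_{y^*}$. The $q$-semivariation is $\|m\|_q(\Omega)=\sup_{y^*\in B_{Y^*}}\|I_{y^*}\|_{\mathcal{P}_q}$; $m$ is of bounded $q$-semivariation if $m$ is bounded and $\|m\|_q(\Omega)<\infty$. If $\|m\|_{p'}(\Omega)<\infty$, the integral $\int_\Omega f\,dm\in Y^{**}$, $f\in\mathcal{C}_p(\Omega,X)$, is the unique bounded linear extension to $\mathcal{C}_p(\Omega,X)$ of $\varphi x\mapsto(\int_\Omega\varphi\,dm)x$, $\varphi\in\mathcal{C}(\Omega)$, $x\in X$. A representing measure of $S\in\mathcal{L}(\mathcal{C}(\Omega),\mathcal{L}(X,Y))$ is a bounded vector measure $m:\Sigma\to\mathcal{L}(X,Y^{**})$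 with $S\varphi=\int_\Omega\varphi\,dm$ for all $\varphi\in\mathcal{C}(\Omega)$. A representing measure of $U\in\mathcal{L}(\mathcal{C}_p(\Omega,X),Y)$ is a vector measure $m:\Sigma\to\mathcal{L}(X,Y^{**})$ of bounded $p'$-semivariation with $Uf=\int_\Omega f\,dm$ for all $f\in\mathcal{C}_p(\Omega,X)$. *)

(* Defs.v *)
From HB Require Import structures.
From mathcomp Require Import all_boot all_order all_algebra.
From mathcomp Require Import all_classical all_reals all_analysis.
From mathcomp Require Import ess_sup_inf complex.

Set Implicit Arguments.
Unset Strict Implicit.
Unset Printing Implicit Defensive.
Import Order.TTheory GRing.Theory Num.Theory.
Import numFieldNormedType.Exports.
Local Open Scope classical_set_scope.
Local Open Scope ring_scope.

Inductive scalar_kind := RealScalars | ComplexScalars.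

Definition scalar_field (R : realType) (k : scalar_kind) : numFieldType :=
  match k with
  | RealScalars => R
  | ComplexScalars => R[i]
  end.

Definition ofR (R : realType) (k : scalar_kind) : R -> scalar_field R k :=
  match k with
  | RealScalars => fun a => a
  | ComplexScalars => fun a => a%:C%C
  end.

Definition toR (R : realType) (k : scalar_kind) : scalar_field R k -> R :=
  match k with
  | RealScalars => fun a => a
  | ComplexScalars => fun a => complex.Re a
  end.

(* A normedModType over K has its norm in K; this is the same norm in R. *)
Definition rnorm (R : realType) (k : scalar_kind)
  (V : normedModType (scalar_field R k)) (x : V) : R := toR `|x|.

Section RealNorm.
Variables (R : realType) (k : scalar_kind).
Notation K := (scalar_field R k).

Lemma ofRK : cancel (@ofR R k) (@toR R k).
Proof. by case: k. Qed.

Lemma ofRD : {morph @ofR R k : a b / a + b}.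
Proof. by case: k => // a b; exact: rmorphD. Qed.

Lemma ofRM : {morph @ofR R k : a b / a * b}.
Proof. by case: k => // a b; exact: rmorphM. Qed.

Lemma ofR0 : @ofR R k 0 = 0.
Proof. by case: k. Qed.

Lemma ofR1 : @ofR R k 1 = 1.
Proof. by case: k. Qed.

Lemma ler_ofR a b : (@ofR R k a <= ofR k b) = (a <= b).
Proof. by case: k => //; exact: lecR. Qed.

Lemma ltr_ofR a b : (@ofR R k a < ofR k b) = (a < b).
Proof. by case: k => //; exact: ltcR. Qed.

Lemma ofR_inj : injective (@ofR R k).
Proof. exact: can_inj ofRK. Qed.

Lemma ge0_toRK (z : K) : 0 <= z -> ofR k (toR z) = z.
Proof. by move: z; case: k => //= z z0; apply: RRe_real; exact: ger0_real. Qed.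

Lemma norm_ofR a : `|@ofR R k a| = ofR k `|a|.
Proof.
case: (leP 0 a) => a0.
  by rewrite !ger0_norm// -ofR0 ler_ofR.
rewrite [in RHS]ltr0_norm// ltr0_norm; last by rewrite -ofR0 ltr_ofR.
by apply/eqP; rewrite eq_sym -subr_eq0 opprK -ofRD addNr ofR0.
Qed.

Implicit Type V : normedModType K.

Lemma normE V (x : V) : `|x| = ofR k (rnorm x).
Proof. by rewrite /rnorm ge0_toRK. Qed.

Lemma rnorm_ge0 V (x : V) : 0 <= rnorm x.
Proof. by rewrite -(ler_ofR) -normE ofR0. Qed.

Lemma rnormD V (x y : V) : rnorm (x + y) <= rnorm x + rnorm y.
Proof. by rewrite -ler_ofR ofRD -!normE ler_normD. Qed.

Lemma rnormN V (x : V) : rnorm (- x) = rnorm x.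
Proof. by rewrite /rnorm normrN. Qed.

Lemma rnorm_dist V (x y : V) : `|rnorm x - rnorm y| <= rnorm (x - y).
Proof.
have H (u v : V) : rnorm u - rnorm v <= rnorm (u - v).
  by rewrite lerBlDr -{1}[u](subrK v) rnormD.
by rewrite ler_norml H andbT lerNl -(rnormN (x - y)) !opprB H.
Qed.

Lemma rnormZ V (a : K) (x : V) : rnorm (a *: x) = rnorm (a : K^o) * rnorm x.
Proof. by apply: ofR_inj; rewrite ofRM -!normE normrZ. Qed.

Lemma rnorm0 V : rnorm (0 : V) = 0.
Proof. by apply: ofR_inj; rewrite -normE normr0 ofR0. Qed.

Lemma rnorm0_eq0 V (x : V) : rnorm x = 0 -> x = 0.
Proof. by move=> x0; apply/eqP; rewrite -normr_eq0 normE x0 ofR0. Qed.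

Lemma rnorm_ofR a : rnorm (ofR k a : K^o) = `|a|.
Proof. by rewrite /rnorm norm_ofR ofRK. Qed.

Lemma rnorm_sum V (I : Type) (r : seq I) (P : pred I) (F : I -> V) :
  rnorm (\sum_(i <- r | P i) F i) <= \sum_(i <- r | P i) rnorm (F i).
Proof.
elim/big_ind2 : _ => // [|x a y b xa yb]; first by rewrite rnorm0.
by rewrite (le_trans (rnormD _ _))// lerD.
Qed.

Lemma cvg_rnormP V (T : Type) (F : set_system T) (f : T -> V) (l : V) :
  Filter F ->
  f @ F --> l <->
  (forall e : R, 0 < e -> \forall t \near F, rnorm (l - f t) <= e).
Proof.
move=> FF; split=> [/cvgrPdist_le fl e e0|fl].
  have := fl (ofR k e); rewrite -ofR0 ltr_ofR => /(_ e0).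
  by apply: filterS => t; rewrite normE ler_ofR.
apply/cvgrPdist_le => e e0.
have eE : ofR k (toR e) = e by rewrite ge0_toRK// ltW.
have /fl : 0 < toR e by rewrite -ltr_ofR eE ofR0.
by apply: filterS => t; rewrite normE -{2}eE ler_ofR.
Qed.

End RealNorm.

Section SupNorm.
Variables (R : realType) (k : scalar_kind) (T : Type).
Variables (V : normedModType (scalar_field R k)) (A : set T).
Implicit Types f g : T -> V.

Definition sup_norm f : R := sup [set rnorm (f t) | t in A].

Definition bounded_on f := exists M, forall t, A t -> rnorm (f t) <= M.

Lemma sup_norm_ub f t : bounded_on f -> A t -> rnorm (f t) <= sup_norm f.
Proof.
move=> [M fM] At; apply: ub_le_sup; last by exists t.
by exists M => _ [s As <-]; exact: fM.
Qed.

Lemma sup_norm_le f c : 0 <= c -> (forall t, A t -> rnorm (f t) <= c) ->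
  sup_norm f <= c.
Proof.
move=> c0 fc; rewrite /sup_norm.
have [->|/set0P A0] := eqVneq A set0; first by rewrite image_set0 sup0.
by apply: ge_sup; [exact: image_nonempty|move=> _ [t At <-]; exact: fc].
Qed.

Lemma sup_norm_ge0 f : bounded_on f -> 0 <= sup_norm f.
Proof.
move=> bf; have [A0|/set0P[t At]] := eqVneq A set0.
  by rewrite /sup_norm A0 image_set0 sup0.
exact: le_trans (rnorm_ge0 _) (sup_norm_ub bf At).
Qed.

Lemma sup_normD f g : bounded_on f -> bounded_on g ->
  sup_norm (f + g) <= sup_norm f + sup_norm g.
Proof.
move=> bf bg; apply: sup_norm_le => [|t At].
  by rewrite addr_ge0 ?sup_norm_ge0.
by rewrite (le_trans (rnormD _ _))// lerD ?sup_norm_ub.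
Qed.

Lemma sup_normZ a f : bounded_on f ->
  sup_norm (a *: f) = rnorm (a : (scalar_field R k)^o) * sup_norm f.
Proof.
move=> bf; apply/eqP; rewrite eq_le; apply/andP; split.
  apply: sup_norm_le => [|t At]; first by rewrite mulr_ge0 ?rnorm_ge0 ?sup_norm_ge0.
  by rewrite rnormZ ler_wpM2l ?rnorm_ge0 ?sup_norm_ub.
have [a0|a0] := eqVneq (rnorm (a : (scalar_field R k)^o)) 0.
  rewrite a0 mul0r; apply: sup_norm_ge0; exists 0 => t At.
  by rewrite rnormZ a0 mul0r.
have a_gt0 : 0 < rnorm (a : (scalar_field R k)^o) by rewrite lt_def a0 rnorm_ge0.
have baf : bounded_on (a *: f).
  move: bf => [M fM]; exists (rnorm (a : (scalar_field R k)^o) * M) => t At.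
  by rewrite rnormZ ler_wpM2l ?rnorm_ge0 ?fM.
rewrite mulrC -ler_pdivlMr//; apply: sup_norm_le => [|t At].
  by rewrite divr_ge0 ?sup_norm_ge0// ltW.
by rewrite ler_pdivlMr// mulrC -rnormZ; exact: (sup_norm_ub baf At).
Qed.

End SupNorm.

Section BoundedOperators.
Variables (R : realType) (k : scalar_kind).
Notation K := (scalar_field R k).
Variables (V W : normedModType K).

Definition bounded_linear_pred : {pred V -> W} := fun f =>
  `[< linear f /\ exists M : R, forall x, rnorm (f x) <= M * rnorm x >].

Record bddop := BddOp {
  bddop_fun :> V -> W;
  _ : bddop_fun \in bounded_linear_pred }.

HB.instance Definition _ := [isSub for bddop_fun].
HB.instance Definition _ := [Choice of bddop by <:].

Lemma bounded_linear_submod : submod_closed bounded_linear_pred.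
Proof.
split=> [|a f g /asboolP[lf [M fM]] /asboolP[lg [N gN]]]; apply/asboolP.
  split=> [b x y|]; first by rewrite /= scaler0 addr0.
  by exists 0 => x; rewrite mul0r rnorm0.
split=> [b x y|].
  rewrite !fctE lf lg !scalerDr !scalerA (mulrC a b).
  by rewrite !addrA; congr (_ + _); rewrite addrAC.
exists (rnorm (a : K^o) * M + N) => x.
rewrite (le_trans (rnormD _ _))// rnormZ mulrDl lerD// -mulrA.
by rewrite ler_wpM2l ?rnorm_ge0.
Qed.

HB.instance Definition _ :=
  GRing.isSubmodClosed.Build K (V -> W) bounded_linear_pred
    bounded_linear_submod.
HB.instance Definition _ := [SubChoice_isSubLmodule of bddop by <:].

Lemma bddop_linear (f : bddop) : linear f.
Proof. by case: f => f /= /asboolP[]. Qed.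

HB.instance Definition _ (f : bddop) :=
  GRing.isLinear.Build K V W _ (bddop_fun f) (bddop_linear f).

Let unit_ball : set V := [set x | rnorm x <= 1].

Lemma bddop_bounded_on (f : bddop) : bounded_on unit_ball f.
Proof.
case: f => f /= /asboolP[lf [M fM]]; exists `|M| => x x1.
rewrite (le_trans (fM x))// (le_trans (ler_norm _))// normrM.
by rewrite ler_piMr// ger0_norm// rnorm_ge0.
Qed.

Definition op_norm (f : bddop) : R := sup_norm unit_ball f.

Lemma op_norm_ge0 f : 0 <= op_norm f.
Proof. by apply: sup_norm_ge0; exact: bddop_bounded_on. Qed.

Lemma op_norm_bound (f : bddop) x : rnorm (f x) <= op_norm f * rnorm x.
Proof.
have [/rnorm0_eq0 ->|x0] := eqVneq (rnorm x) 0.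
  by rewrite linear0 !rnorm0 mulr0.
have xp : 0 < rnorm x by rewrite lt_def x0 rnorm_ge0.
rewrite -ler_pdivrMr//; set a := ofR k (rnorm x)^-1.
have aE : rnorm (a : K^o) = (rnorm x)^-1 by rewrite rnorm_ofR ger0_norm// invr_ge0 ltW.
have : rnorm (f (a *: x)) <= op_norm f.
  apply: sup_norm_ub; first exact: bddop_bounded_on.
  by rewrite /unit_ball /= rnormZ aE mulVf.
by rewrite linearZ rnormZ aE mulrC.
Qed.

Lemma bddop_normD (f g : bddop) :
  ofR k (op_norm (f + g)) <= ofR k (op_norm f) + ofR k (op_norm g).
Proof. by rewrite -ofRD ler_ofR; apply: sup_normD; exact: bddop_bounded_on. Qed.

Lemma bddop_normZ a (f : bddop) :
  ofR k (op_norm (a *: f)) = `|a| * ofR k (op_norm f).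
Proof.
have -> : `|a| = ofR k (rnorm (a : K^o)) by rewrite -(@normE _ _ K^o).
rewrite -ofRM; congr ofR; by apply: sup_normZ; exact: bddop_bounded_on.
Qed.

Lemma bddop_norm0_eq0 (f : bddop) : ofR k (op_norm f) = 0 -> f = 0.
Proof.
rewrite -(ofR0 R k) => /ofR_inj f0; apply/val_inj/funext => x /=.
apply/rnorm0_eq0/eqP; rewrite eq_le rnorm_ge0 andbT.
by have := op_norm_bound f x; rewrite f0 mul0r.
Qed.

HB.instance Definition _ := Lmodule_isNormed.Build K bddop
  bddop_normD bddop_normZ bddop_norm0_eq0.

End BoundedOperators.

Section Duals.
Variables (R : realType) (k : scalar_kind).
Notation K := (scalar_field R k).
Implicit Types V W Z : normedModType K.

Lemma rnormE V W (f : bddop V W) : rnorm f = op_norm f.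
Proof. exact: ofRK. Qed.

Lemma bddopP V W (f : V -> W) : linear f ->
  (exists M : R, forall x, rnorm (f x) <= M * rnorm x) ->
  f \in @bounded_linear_pred _ _ V W.
Proof. by move=> lf bf; apply/asboolP. Qed.

Definition mk_bddop V W (f : V -> W) (lf : linear f)
    (bf : exists M : R, forall x, rnorm (f x) <= M * rnorm x) : bddop V W :=
  BddOp (bddopP lf bf).

Definition closed_unit_ball V : set V := [set x | rnorm x <= 1].

Definition dual_space V : normedModType K := bddop V (K^o : normedModType K).

Definition bidual_space V : normedModType K := dual_space (dual_space V).

Lemma eval_linear V (x : V) : linear (fun f : dual_space V => f x : K^o).
Proof. by move=> a f g. Qed.

Lemma eval_bounded V (x : V) : exists M : R, forall f : dual_space V,
  rnorm (f x : K^o) <= M * rnorm f.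
Proof.
by exists (rnorm x) => f; rewrite mulrC rnormE; exact: op_norm_bound.
Qed.

Definition bidual_embed V (x : V) : bidual_space V :=
  mk_bddop (@eval_linear V x) (eval_bounded x).

Lemma bidual_embed_linear V : linear (@bidual_embed V).
Proof.
by move=> a x y; apply/val_inj/funext => f /=; rewrite linearP.
Qed.

Lemma bidual_embed_bounded V :
  exists M : R, forall x : V, rnorm (bidual_embed x) <= M * rnorm x.
Proof.
exists 1 => x; rewrite mul1r rnormE; apply: sup_norm_le => [|f f1].
  exact: rnorm_ge0.
rewrite (le_trans (op_norm_bound f x))// ler_piMl ?rnorm_ge0//.
by rewrite -rnormE.
Qed.

Definition bidual_map V : bddop V (bidual_space V) :=
  mk_bddop (@bidual_embed_linear V) (bidual_embed_bounded V).

Lemma comp_linear V W Z (g : bddop W Z) (f : bddop V W) : linear (g \o f).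
Proof. by move=> a x y; rewrite /= !linearP. Qed.

Lemma comp_bounded V W Z (g : bddop W Z) (f : bddop V W) :
  exists M : R, forall x, rnorm ((g \o f) x) <= M * rnorm x.
Proof.
exists (op_norm g * op_norm f) => x; rewrite (le_trans (op_norm_bound _ _))//.
by rewrite -mulrA ler_wpM2l ?op_norm_ge0 ?op_norm_bound.
Qed.

Definition comp_op V W Z (g : bddop W Z) (f : bddop V W) : bddop V Z :=
  mk_bddop (comp_linear g f) (comp_bounded g f).

End Duals.
Arguments closed_unit_ball {R k} V _.

Record compactHausdorffType := CompactHausdorff {
  ch_space :> topologicalType;
  ch_compact : compact [set: ch_space];
  ch_hausdorff : hausdorff_space ch_space }.

Section ContinuousFunctions.
Variables (R : realType) (k : scalar_kind).
Notation K := (scalar_field R k).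
Variables (Omega : compactHausdorffType) (V : normedModType K).

Definition continuous_pred : {pred Omega -> V} := fun f => `[< continuous f >].

Record contf := Contf {
  contf_fun :> Omega -> V;
  _ : contf_fun \in continuous_pred }.

HB.instance Definition _ := [isSub for contf_fun].
HB.instance Definition _ := [Choice of contf by <:].

Lemma continuous_submod : submod_closed continuous_pred.
Proof.
split=> [|a f g /asboolP cf /asboolP cg]; apply/asboolP.
  exact: cst_continuous.
move=> w; apply: (@cvgD _ _ _ _ _ (a *: f : Omega -> V) g) => //; last exact: cg.
by apply: (@cvgZl_tmp _ _ _ _ _ a f); exact: cf.
Qed.

HB.instance Definition _ :=
  GRing.isSubmodClosed.Build K (Omega -> V) continuous_pred continuous_submod.
HB.instance Definition _ := [SubChoice_isSubLmodule of contf by <:].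

Lemma contf_continuous (f : contf) : continuous f.
Proof. by case: f => f /= /asboolP. Qed.

Lemma contf_bounded_on (f : contf) : bounded_on setT f.
Proof.
have cnf : continuous (fun w => rnorm (f w) : R^o).
  move=> w; apply/cvgrPdist_le => e e0.
  have /cvg_rnormP /(_ e e0) := @contf_continuous f w.
  by apply: filterS => t; apply: le_trans; exact: rnorm_dist.
have /compact_bounded[M [_ fM]] : compact (range (fun w => rnorm (f w) : R^o)).
  apply: continuous_compact; last exact: ch_compact.
  exact: continuous_subspaceT.
exists (M + 1) => w _; rewrite (le_trans (ler_norm _))//.
by apply: fM; [rewrite ltrDl|exists w].
Qed.

Lemma contf_normD (f g : contf) :
  ofR k (sup_norm setT (f + g)) <= ofR k (sup_norm setT f) + ofR k (sup_norm setT g).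
Proof. by rewrite -ofRD ler_ofR; apply: sup_normD; exact: contf_bounded_on. Qed.

Lemma contf_normZ a (f : contf) :
  ofR k (sup_norm setT (a *: f)) = `|a| * ofR k (sup_norm setT f).
Proof.
have -> : `|a| = ofR k (rnorm (a : K^o)) by rewrite -(@normE _ _ K^o).
rewrite -ofRM; congr ofR; by apply: sup_normZ; exact: contf_bounded_on.
Qed.

Lemma contf_norm0_eq0 (f : contf) : ofR k (sup_norm setT f) = 0 -> f = 0.
Proof.
rewrite -(ofR0 R k) => /ofR_inj f0; apply/val_inj/funext => w /=.
apply/rnorm0_eq0/eqP; rewrite eq_le rnorm_ge0 andbT -f0.
by apply: sup_norm_ub => //; exact: contf_bounded_on.
Qed.

HB.instance Definition _ := Lmodule_isNormed.Build K contf
  contf_normD contf_normZ contf_norm0_eq0.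

Lemma contf_rnormE (f : contf) : rnorm f = sup_norm setT f.
Proof. exact: ofRK. Qed.

End ContinuousFunctions.

Definition scalar_contf (R : realType) (k : scalar_kind)
    (Omega : compactHausdorffType) : normedModType (scalar_field R k) :=
  contf Omega ((scalar_field R k)^o : normedModType (scalar_field R k)).

Section Tensors.
Variables (R : realType) (k : scalar_kind).
Notation K := (scalar_field R k).
Variables (Omega : compactHausdorffType) (X : normedModType K).

Lemma tensor_continuous (phi : scalar_contf R k Omega) (x : X) :
  (fun w => phi w *: x) \in @continuous_pred _ _ Omega X.
Proof. apply/asboolP => w; apply: cvgZr_tmp; exact: contf_continuous. Qed.

Definition tensor (phi : scalar_contf R k Omega) (x : X) :
  contf Omega X := Contf (tensor_continuous phi x).
End Tensors.

Section SequenceSpaces.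
Variables (R : realType) (k : scalar_kind).
Notation K := (scalar_field R k).
Implicit Types (V : normedModType K) (p : \bar R).

Definition lp_norm p V (x : nat -> V) : \bar R :=
  ('N[counting]_p[(fun n => (rnorm (x n))%:E)])%E.

(* Membership in l_p(V), with c_0(V) in place of l_oo(V). *)
Definition in_lp p V (x : nat -> V) : Prop :=
  (lp_norm p x < +oo)%E /\ (p = +oo%E -> x @ \oo --> (0 : V)).

Definition lp_le p (u : nat -> R) (c : R) : Prop :=
  match p with
  | r%:E => forall N, \sum_(0 <= n < N) u n `^ r <= c `^ r
  | +oo%E => forall n, u n <= c
  | -oo%E => False
  end.

Lemma counting_aeP (P : nat -> Prop) :
  (\forall n \ae (@counting nat R), P n) <-> forall n, P n.
Proof.
split=> [[A [mA A0 sA]] n|H]; last exact: aeW.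
apply: contrapT => nPn.
have An : A n by exact: sA.
have : (counting [set n] <= counting A :> \bar R)%E.
  by apply: le_measure; rewrite ?inE// => _ ->.
rewrite A0 /counting asboolT; last exact: finite_set1.
by rewrite fset_set1 finmap.cardfs1 lee_fin ler10.
Qed.

Lemma lp_normP p V (x : nat -> V) c : (1 <= p)%E -> 0 <= c ->
  (lp_norm p x <= c%:E)%E <-> lp_le p (fun n => rnorm (x n)) c.
Proof.
case: p => [r||//] p1 c0 /=; last first.
  rewrite /lp_norm unlock ifT; last first.
    suff : (0 < @counting nat R [set: nat])%E by [].
    by rewrite /counting asboolF ?ltry//; exact: infinite_nat.
  split=> [/ess_supP /counting_aeP H n|H].
    by have := H n; rewrite /= lee_fin ger0_norm ?rnorm_ge0.
  by apply/ess_supP/counting_aeP => n; rewrite /= lee_fin ger0_norm ?rnorm_ge0.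
have r0 : 0 < r by rewrite (lt_le_trans ltr01)// -lee_fin.
rewrite /lp_norm Lnorm_counting//.
have s0 : (0 <= \sum_(n <oo) `|(rnorm (x n))%:E| `^ r)%E.
  by apply: nneseries_ge0 => n _ _; exact: poweR_ge0.
have eqc : (c%:E = (c `^ r)%:E `^ r^-1)%E.
  by rewrite poweR_EFin -powRrM divff ?gt_eqF// powRr1.
have parE N : (\sum_(0 <= n < N) `|(rnorm (x n))%:E| `^ r =
   (\sum_(0 <= n < N) rnorm (x n) `^ r)%:E)%E.
  rewrite -sumEFin; apply: eq_bigr => n _.
  by rewrite abse_EFin poweR_EFin ger0_norm ?rnorm_ge0.
split=> [sc N|H].
  rewrite -lee_fin -parE; apply: (@le_trans _ _ (\sum_(n <oo) `|(rnorm (x n))%:E| `^ r)%E).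
    by apply: nneseries_lim_ge => n _ _; exact: poweR_ge0.
  rewrite -[leLHS]poweRe1// -(@mulVf _ r) ?gt_eqF// poweRrM -poweR_EFin.
  apply: gt0_ler_poweR sc; first exact: ltW.
    by rewrite in_itv/= leey poweR_ge0.
  by rewrite in_itv/= leey lee_fin c0.
rewrite eqc; apply: gt0_ler_poweR; rewrite ?invr_ge0 ?(ltW r0)//.
- by rewrite in_itv/= leey s0.
- by rewrite in_itv/= leey lee_fin powR_ge0.
apply: lime_le; first by apply: is_cvg_nneseries => n _ _; exact: poweR_ge0.
by apply: nearW => N; rewrite parE lee_fin.
Qed.

Lemma lp_norm_ge0 p V (x : nat -> V) : (0 <= lp_norm p x)%E.
Proof. exact: Lnorm_ge0. Qed.

Lemma lp_norm_fin p V (x : nat -> V) : in_lp p x ->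
  lp_norm p x = (fine (lp_norm p x))%:E.
Proof. by move=> [xoo _]; rewrite fineK// ge0_fin_numE ?lp_norm_ge0. Qed.

End SequenceSpaces.

Section Interleaving.

Definition interleave (T : Type) (x z : nat -> T) : nat -> T :=
  fun n => if odd n then z n./2 else x n./2.

Lemma sum_interleave (U : zmodType) (x z : nat -> U) N :
  \sum_(0 <= n < N) interleave x z n =
  \sum_(0 <= n < uphalf N) x n + \sum_(0 <= n < N./2) z n.
Proof.
elim: N => [|N IH]; first by rewrite !big_nil addr0.
rewrite big_nat_recr//= IH /interleave uphalf_half.
case: (odd N); rewrite ?add0n ?add1n.
  by rewrite [X in _ = _ + X]big_nat_recr//= addrA.
by rewrite [X in _ = X + _]big_nat_recr//= addrAC.
Qed.

Variable R : realType.
Implicit Types (p : \bar R) (u v : nat -> R).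

Lemma lp_le_interleave r u v (s t A B C : R) : 0 < r ->
  (forall n, 0 <= u n) -> (forall n, 0 <= v n) ->
  0 <= s -> 0 <= t -> 0 <= A -> 0 <= B ->
  (s * A) `^ r + (t * B) `^ r <= C `^ r ->
  lp_le r%:E u A -> lp_le r%:E v B ->
  lp_le r%:E (interleave (fun n => s * u n) (fun n => t * v n)) C.
Proof.
move=> r0 u0 v0 s0 t0 A0 B0 CE uA vB N.
rewrite (_ : \sum_(0 <= n < N) _ = \sum_(0 <= n < N)
   interleave (fun n => (s * u n) `^ r) (fun n => (t * v n) `^ r) n); last first.
  by apply: eq_bigr => n _; rewrite /interleave; case: ifP.
rewrite sum_interleave (le_trans _ CE)// !powRM// lerD//.
  under eq_bigr do rewrite powRM//.
  by rewrite -mulr_sumr ler_wpM2l ?powR_ge0.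
under eq_bigr do rewrite powRM//.
by rewrite -mulr_sumr ler_wpM2l ?powR_ge0.
Qed.

Lemma lpy_le_interleave u v (s t A B C : R) :
  0 <= s -> 0 <= t -> s * A <= C -> t * B <= C ->
  lp_le +oo u A -> lp_le +oo v B ->
  lp_le +oo (interleave (fun n => s * u n) (fun n => t * v n)) C.
Proof.
move=> s0 t0 sA tB uA vB n; rewrite /interleave; case: ifP => _.
  by rewrite (le_trans _ tB)// ler_wpM2l.
by rewrite (le_trans _ sA)// ler_wpM2l.
Qed.

Lemma lp_le_scale p u (s A : R) : (1 <= p)%E -> (forall n, 0 <= u n) ->
  0 <= s -> 0 <= A ->
  lp_le p u A -> lp_le p (fun n => s * u n) (s * A).
Proof.
case: p => [r||//] p1 u0 s0 A0 uA; last by move=> n; rewrite ler_wpM2l.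
move=> N; rewrite powRM//; under eq_bigr do rewrite powRM//.
by rewrite -mulr_sumr ler_wpM2l ?powR_ge0.
Qed.

Lemma hoelder_conjugateE (r : R) : 1 < r ->
  hoelder_conjugate r%:E = (r / (r - 1))%:E.
Proof.
move=> r1; rewrite /hoelder_conjugate/= gt_eqF ?lte_fin ?(lt_trans ltr01)//.
by rewrite -EFinD inver subr_eq0 gt_eqF.
Qed.

Lemma interleave_weights p (A B : R) : (1 <= p)%E -> 0 < A -> 0 < B ->
  exists s t : R, [/\ 0 < s, 0 < t,
    forall u v, (forall n, 0 <= u n) -> (forall n, 0 <= v n) ->
      lp_le p u A -> lp_le p v B ->
      lp_le p (interleave (fun n => s * u n) (fun n => t * v n)) (A + B) &
    forall u v, (forall n, 0 <= u n) -> (forall n, 0 <= v n) ->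
      lp_le (hoelder_conjugate p) u 1 -> lp_le (hoelder_conjugate p) v 1 ->
      lp_le (hoelder_conjugate p)
        (interleave (fun n => s^-1 * u n) (fun n => t^-1 * v n)) 1].
Proof.
move=> p1 A0 B0; have AB0 : 0 < A + B by rewrite addr_gt0.
have A1 : 0 < (A + B) / A by rewrite divr_gt0.
have B1 : 0 < (A + B) / B by rewrite divr_gt0.
have AB1 : A / (A + B) + B / (A + B) = 1 by rewrite -mulrDl divff// gt_eqF.
case: p p1 => [r||//]; last first.
  move=> _; exists ((A + B) / A), ((A + B) / B); split => //.
    move=> u v u0 v0; apply: lpy_le_interleave.
    - exact: ltW.
    - exact: ltW.
    - by rewrite divfK ?gt_eqF.
    - by rewrite divfK ?gt_eqF.
  move=> u v u0 v0; rewrite hoelder_conjugatey.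
  apply: lp_le_interleave => //; rewrite ?invr_ge0 ?(ltW A1) ?(ltW B1)//.
  by rewrite !mulr1 !powRr1 ?invr_ge0 ?(ltW A1) ?(ltW B1)// !invf_div AB1.
rewrite lee_fin le_eqVlt => /predU1P[<-|r1].
  exists 1, 1; split; rewrite ?ltr01// ?hoelder_conjugate1.
    move=> u v u0 v0; apply: lp_le_interleave => //; rewrite ?(ltW A0) ?(ltW B0)//.
    by rewrite !mul1r !powRr1 ?(ltW A0) ?(ltW B0) ?(ltW AB0).
  by move=> u v u0 v0; apply: lpy_le_interleave; rewrite ?invr1 ?mulr1.
have r0 : 0 < r by exact: lt_trans ltr01 r1.
have r10 : 0 < r - 1 by rewrite subr_gt0.
pose q := r / (r - 1).
have q0 : 0 < q by rewrite divr_gt0.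
have W D : 0 < D -> (((A + B) / D) `^ q^-1 * D) `^ r = (A + B) `^ (r - 1) * D.
  move=> D0; rewrite powRM ?powR_ge0 ?(ltW D0)// -powRrM.
  have -> : q^-1 * r = r - 1 by rewrite /q invf_div divfK// gt_eqF.
  rewrite powRM ?invr_ge0 ?(ltW D0) ?(ltW AB0)// -mulrA; congr (_ * _).
  rewrite -powR_inv1 ?(ltW D0)// -powRrM -powRD; last by rewrite (gt_eqF D0) implybT.
  by rewrite mulN1r opprB subrK powRr1// ltW.
have W' D : 0 < D -> ((((A + B) / D) `^ q^-1)^-1) `^ q = D / (A + B).
  move=> D0; rewrite -powR_inv1 ?powR_ge0// -powRrM mulN1r -powRrM.
  by rewrite mulrN mulVf ?gt_eqF// powR_inv1 ?divr_ge0 ?ltW// invf_div.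
exists (((A + B) / A) `^ q^-1), (((A + B) / B) `^ q^-1).
split; rewrite ?powR_gt0 ?divr_gt0//.
  move=> u v u0 v0; apply: lp_le_interleave;
    rewrite ?powR_ge0 ?(ltW A0) ?(ltW B0)//.
  rewrite !W// -mulrDr.
  by rewrite -[X in _ * X <= _]powRr1 ?(ltW AB0)// -powRD ?subrK// gt_eqF ?implybT.
move=> u v u0 v0; rewrite hoelder_conjugateE//.
apply: lp_le_interleave; rewrite ?invr_ge0 ?powR_ge0//.
by rewrite !mulr1 !W'// AB1 powR1.
Qed.

Lemma lp_le_pairing p u v (c : R) N : (1 <= p)%E ->
  (forall n, 0 <= u n) -> (forall n, 0 <= v n) -> 0 < c ->
  lp_le p u c -> lp_le (hoelder_conjugate p) v 1 ->
  \sum_(0 <= n < N) v n * u n <= c.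
Proof.
move=> + u0 v0 c0; case: p => [r||//]; last first.
  rewrite hoelder_conjugatey => _ /= uc /(_ N); rewrite powR1 => v1.
  apply: (@le_trans _ _ (\sum_(0 <= n < N) v n `^ 1 * c)).
    by apply: ler_sum => n _; rewrite powRr1// ler_wpM2l.
  by rewrite -mulr_suml ler_piMl// ltW.
rewrite lee_fin le_eqVlt => /predU1P[<-|r1].
  rewrite hoelder_conjugate1 => /= /(_ N); rewrite powRr1 ?(ltW c0)// => uc v1.
  by apply: le_trans uc; apply: ler_sum => n _; rewrite powRr1// ler_piMl.
have r0 : 0 < r by exact: lt_trans ltr01 r1.
have r10 : 0 < r - 1 by rewrite subr_gt0.
rewrite hoelder_conjugateE// => uc v1.
have q0 : 0 < r / (r - 1) by rewrite divr_gt0.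
rewrite -[leRHS]mulr1 mulrC -ler_pdivrMr// mulr_suml.
apply: (@le_trans _ _ (\sum_(0 <= n < N)
    ((u n / c) `^ r / r + v n `^ (r / (r - 1)) / (r / (r - 1))))).
  apply: ler_sum => n _; rewrite -mulrA mulrC; apply: conjugate_powR => //.
    by rewrite divr_ge0// ltW.
  by rewrite invf_div -[X in X + _]mul1r -mulrDl addrC subrK divff ?gt_eqF.
rewrite big_split/= -!mulr_suml.
have ur : \sum_(0 <= n < N) (u n / c) `^ r <= 1.
  under eq_bigr do rewrite powRM ?invr_ge0 ?(ltW c0)//.
  rewrite -mulr_suml -(@powR_inv1 _ c) ?(ltW c0)// -powRrM mulN1r powRN.
  by rewrite ler_pdivrMr ?powR_gt0// mul1r.
have := v1 N; rewrite powR1 => {}v1.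
rewrite (@le_trans _ _ (1 / r + 1 / (r / (r - 1))))//.
  by rewrite lerD// ler_pM2r ?invr_gt0.
by rewrite !mul1r invf_div -[X in X + _]mul1r -mulrDl addrC subrK divff ?gt_eqF.
Qed.

End Interleaving.

Section PContinuousFunctions.
Variables (R : realType) (k : scalar_kind) (p : \bar R) (p1 : (1 <= p)%E).
Notation K := (scalar_field R k).
Variables (Omega : compactHausdorffType) (X : normedModType K).

(* { sum_n a_n x_n : (a_n) in the closed unit ball of l_p' } *)
Definition p_hull (x : nat -> X) : set X :=
  [set y | exists2 a : nat -> (K^o : normedModType K),
     (lp_norm (hoelder_conjugate p) a <= 1)%E &
     series (fun n => (a n : K) *: x n) @ \oo --> y].

Definition p_represents (x : nat -> X) (f : Omega -> X) : Prop :=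
  in_lp p x /\ range f `<=` p_hull x.

Definition p_continuous_pred : {pred contf Omega X} := fun f =>
  `[< exists x, p_represents x f >].

Definition cp_norm (f : Omega -> X) : R :=
  inf [set fine (lp_norm p x) | x in [set x | p_represents x f]].

Let q1 : (1 <= hoelder_conjugate p)%E := hoelder_conj_ge1 p1.

Lemma p_represents_scale a x f : p_represents x f ->
  p_represents (fun n => a *: x n) (a *: f).
Proof.
move=> [[xoo x0] fx]; split; last first.
  move=> _ [w _ <-]; have [b b1 bx] := fx (f w) (ex_intro2 _ _ w I erefl).
  exists b => //.
  rewrite (_ : series _ = a \*: series (fun n => (b n : K) *: x n)).
    exact: cvgZl_tmp.
  apply/funext => N; rewrite /series/= scaler_sumr; apply: eq_bigr => n _.
  by rewrite !scalerA mulrC.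
split; last first.
  move=> /x0 {}x0; rewrite -(scaler0 _ a); exact: cvgZl_tmp.
have [M M0 xM] : exists2 M, 0 <= M & (lp_norm p x <= M%:E)%E.
  exists (fine (lp_norm p x)); first by rewrite fine_ge0 ?lp_norm_ge0.
  by rewrite fineK// ge0_fin_numE ?lp_norm_ge0.
apply: (@le_lt_trans _ _ (rnorm (a : K^o) * M)%:E); last exact: ltry.
apply/lp_normP => //; first by rewrite mulr_ge0 ?rnorm_ge0.
under eq_fun do rewrite rnormZ.
apply: lp_le_scale => //; try by move=> *; exact: rnorm_ge0.
exact/lp_normP.
Qed.

Lemma lp_norm_scale a (x : nat -> X) (M : R) : 0 <= M ->
  (lp_norm p x <= M%:E)%E ->
  (lp_norm p (fun n => a *: x n) <= (rnorm (a : K^o) * M)%:E)%E.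
Proof.
move=> M0 xM; apply/lp_normP => //; first by rewrite mulr_ge0 ?rnorm_ge0.
under eq_fun do rewrite rnormZ.
apply: lp_le_scale => //; try by move=> *; exact: rnorm_ge0.
exact/lp_normP.
Qed.

Lemma p_represents_add x z f g (A B : R) : 0 < A -> 0 < B ->
  p_represents x f -> p_represents z g ->
  (lp_norm p x <= A%:E)%E -> (lp_norm p z <= B%:E)%E ->
  exists2 y, p_represents y (f + g) & (lp_norm p y <= (A + B)%:E)%E.
Proof.
move=> A0 B0 [[xoo x0] fx] [[zoo z0] gz] xA zB.
have [s [t [s0 t0 Hst Kst]]] := interleave_weights p1 A0 B0.
pose y := interleave (fun n => ofR k s *: x n) (fun n => ofR k t *: z n).
have sE (u : R) : 0 < u -> rnorm (ofR k u : K^o) = u.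
  by move=> u0; rewrite rnorm_ofR gtr0_norm.
have yE : (lp_norm p y <= (A + B)%:E)%E.
  apply/lp_normP => //; first by rewrite addr_ge0 ?ltW.
  rewrite (_ : (fun n => _) =
    interleave (fun n => s * rnorm (x n)) (fun n => t * rnorm (z n))).
    apply: Hst; try by move=> *; exact: rnorm_ge0.
      by apply/lp_normP => //; exact: ltW.
    by apply/lp_normP => //; exact: ltW.
  by apply/funext => n; rewrite /y /interleave; case: ifP; rewrite rnormZ sE.
exists y => //; split.
  split; first exact: le_lt_trans yE (ltry _).
  move=> /[dup] /x0 {}x0 /z0 {}z0; apply/cvg_rnormP => e e0.
  have /cvg_rnormP /(_ e e0) [N1 _ N1e] : (fun n => ofR k s *: x n) @ \oo --> (0 : X).
    by rewrite -(scaler0 _ (ofR k s)); exact: cvgZl_tmp.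
  have /cvg_rnormP /(_ e e0) [N2 _ N2e] : (fun n => ofR k t *: z n) @ \oo --> (0 : X).
    by rewrite -(scaler0 _ (ofR k t)); exact: cvgZl_tmp.
  exists (maxn N1 N2).*2 => // n /= Nn; rewrite /y /interleave.
  have : (maxn N1 N2 <= n./2)%N by rewrite -(doubleK (maxn _ _)) half_leq.
  by rewrite geq_max => /andP[h1 h2]; case: ifP => _; [exact: N2e|exact: N1e].
move=> _ [w _ <-].
have [a a1 ax] := fx (f w) (ex_intro2 _ _ w I erefl).
have [b b1 bz] := gz (g w) (ex_intro2 _ _ w I erefl).
pose c : nat -> (K^o : normedModType K) :=
  interleave (fun n => ofR k s^-1 * (a n : K)) (fun n => ofR k t^-1 * (b n : K)).
exists c.
  apply/lp_normP => //.
  rewrite (_ : (fun n => _) =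
    interleave (fun n => s^-1 * rnorm (a n)) (fun n => t^-1 * rnorm (b n))).
    apply: Kst; try by move=> *; exact: rnorm_ge0.
      by apply/lp_normP.
    by apply/lp_normP.
  apply/funext => n; rewrite /c /interleave.
  by case: ifP => _; rewrite (@rnormZ _ _ K^o) sE ?invr_gt0.
rewrite (_ : series _ = (fun N =>
  series (fun n => (a n : K) *: x n) (uphalf N) +
  series (fun n => (b n : K) *: z n) N./2)).
  apply: cvgD.
    apply: (cvg_comp _ _ _ ax) => S [N _ NS]; exists N.*2 => // n /= Nn.
    apply: NS => /=; rewrite uphalf_half (leq_trans _ (leq_addl _ _))//.
    by rewrite -(doubleK N) half_leq.
  apply: (cvg_comp _ _ _ bz) => S [N _ NS]; exists N.*2 => // n /= Nn.
  by apply: NS => /=; rewrite -(doubleK N) half_leq.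
apply/funext => N; rewrite /series/= -sum_interleave; apply: eq_bigr => n _.
rewrite /c /y /interleave.
have sV (u : R) : 0 < u -> ofR k u^-1 * ofR k u = 1.
  by move=> u0; rewrite -ofRM mulVf ?ofR1// gt_eqF.
by case: ifP => _; rewrite scalerA mulrAC sV ?mul1r.
Qed.

Lemma lp_norm0 : lp_norm p (fun=> 0 : X) = 0%E.
Proof.
apply/eqP; rewrite eq_le lp_norm_ge0 andbT; apply/lp_normP => //.
under eq_fun do rewrite rnorm0.
case: (p) p1 => [r||//] //= r1 N; rewrite powR0; first by rewrite big1.
by rewrite gt_eqF// (lt_le_trans ltr01)// -lee_fin.
Qed.

Lemma p_represents0 : p_represents (fun=> 0) 0.
Proof.
split; first by split; [rewrite lp_norm0|move=> _; exact: cvg_cst].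
move=> _ [w _ <-]; exists (fun=> 0).
  apply/lp_normP => //; under eq_fun do rewrite rnorm0.
  case: (hoelder_conjugate p) q1 => [r||//] //= r1 N.
  rewrite big1 ?powR_ge0// => n _; rewrite powR0// gt_eqF//.
  by rewrite (lt_le_trans ltr01)// -lee_fin.
rewrite (_ : series _ = cst 0); first exact: cvg_cst.
by apply/funext => N; rewrite /series/= big1// => n _; rewrite scaler0.
Qed.

Lemma lp_norm_witness x f : p_represents x f ->
  exists2 M : R, 0 < M & (lp_norm p x <= M%:E)%E.
Proof.
move=> [[xoo _] _]; exists (fine (lp_norm p x) + 1).
  by rewrite ltr_wpDl ?fine_ge0 ?lp_norm_ge0.
rewrite -[leLHS]fineK ?ge0_fin_numE ?lp_norm_ge0//.
by rewrite lee_fin lerDl.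
Qed.

Lemma p_continuous_submod : submod_closed p_continuous_pred.
Proof.
split=> [|a f g /asboolP[x xf] /asboolP[z zg]]; apply/asboolP.
  by exists (fun=> 0); exact: p_represents0.
have axf := p_represents_scale a xf.
have [A A0 xA] := lp_norm_witness axf.
have [B B0 zB] := lp_norm_witness zg.
have [y yfg _] := p_represents_add A0 B0 axf zg xA zB.
by exists y.
Qed.

Lemma cp_norm_has_lbound f :
  has_lbound [set fine (lp_norm p x) | x in [set x | p_represents x f]].
Proof. by exists 0 => _ [y _ <-]; rewrite fine_ge0 ?lp_norm_ge0. Qed.

Lemma cp_norm_ge0 f : 0 <= cp_norm f.
Proof.
have [E0|/set0P E0] :=
    eqVneq [set fine (lp_norm p x) | x in [set x | p_represents x f]] set0.
  by rewrite /cp_norm E0 inf0.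
by apply: lb_le_inf => // _ [y _ <-]; rewrite fine_ge0 ?lp_norm_ge0.
Qed.

Lemma cp_norm_le x f (M : R) : 0 <= M -> p_represents x f ->
  (lp_norm p x <= M%:E)%E -> cp_norm f <= M.
Proof.
move=> M0 xf xM; apply: (@le_trans _ _ (fine (lp_norm p x))).
  by apply: ge_inf; [exact: cp_norm_has_lbound|exists x].
by rewrite -lee_fin fineK// ge0_fin_numE ?lp_norm_ge0 ?(le_lt_trans xM) ?ltry.
Qed.

Lemma cp_norm_adherent (f : contf Omega X) e : f \in p_continuous_pred ->
  0 < e -> exists2 x, p_represents x f & (lp_norm p x <= (cp_norm f + e)%:E)%E.
Proof.
move=> /asboolP[z zf] e0.
have [|_ [x xf <-] /ltW xe] := @inf_adherent _
    [set fine (lp_norm p x) | x in [set x | p_represents x f]] _ e0.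
  split; last exact: cp_norm_has_lbound.
  by exists (fine (lp_norm p z)); exists z.
by exists x => //; rewrite -[leLHS]fineK ?lee_fin// ge0_fin_numE ?lp_norm_ge0 ?(proj1 (proj1 xf)).
Qed.

(* The proof argument is there for the norm, which needs 1 <= p. *)
Record cpf (le1p : (1 <= p)%E) := Cpf {
  cpf_contf :> contf Omega X;
  _ : cpf_contf \in p_continuous_pred }.

HB.instance Definition _ := [isSub of cpf p1 for @cpf_contf p1].
HB.instance Definition _ := [Choice of cpf p1 by <:].
HB.instance Definition _ :=
  GRing.isSubmodClosed.Build K (contf Omega X) p_continuous_pred
    p_continuous_submod.
HB.instance Definition _ := [SubChoice_isSubLmodule of cpf p1 by <:].

Lemma cpfP (f : cpf p1) : cpf_contf f \in p_continuous_pred.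
Proof. by case: f. Qed.

Lemma cpf_normD (f g : cpf p1) :
  ofR k (cp_norm (f + g)) <= ofR k (cp_norm f) + ofR k (cp_norm g).
Proof.
rewrite -ofRD ler_ofR; apply/ler_addgt0Pr => e e0.
have e2 : 0 < e / 2 by rewrite divr_gt0.
have [x xf xM] := cp_norm_adherent (cpfP f) e2.
have [z zg zM] := cp_norm_adherent (cpfP g) e2.
have A0 : 0 < cp_norm f + e / 2 by rewrite ltr_wpDl ?cp_norm_ge0.
have B0 : 0 < cp_norm g + e / 2 by rewrite ltr_wpDl ?cp_norm_ge0.
have [y yfg yM] := p_represents_add A0 B0 xf zg xM zM.
rewrite [e]splitr addrACA; apply: cp_norm_le yfg yM.
by rewrite addr_ge0// ltW.
Qed.

Lemma cp_normZ_le a (f : cpf p1) :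
  cp_norm (a *: f) <= rnorm (a : K^o) * cp_norm f.
Proof.
set b := rnorm _; have b0 : 0 <= b by exact: rnorm_ge0.
apply/ler_addgt0Pr => e e0.
have e2 : 0 < e / (b + 1) by rewrite divr_gt0// ltr_wpDl.
have [x xf xM] := cp_norm_adherent (cpfP f) e2.
have M0 : 0 <= cp_norm f + e / (b + 1) by rewrite addr_ge0 ?cp_norm_ge0 ?ltW.
apply: le_trans (cp_norm_le _ (p_represents_scale a xf) (lp_norm_scale a M0 xM)) _.
  by rewrite mulr_ge0.
rewrite -/b mulrDr lerD2l mulrA ler_pdivrMr ?ltr_wpDl// mulrC.
by rewrite ler_wpM2l ?(ltW e0)// lerDl.
Qed.

Lemma cpf_normZ a (f : cpf p1) :
  ofR k (cp_norm (a *: f)) = `|a| * ofR k (cp_norm f).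
Proof.
have -> : `|a| = ofR k (rnorm (a : K^o)) by rewrite -(@normE _ _ K^o).
rewrite -ofRM; congr ofR; apply/eqP; rewrite eq_le cp_normZ_le /=.
have [->|a0] := eqVneq a 0.
  by rewrite (@rnorm0 _ _ K^o) mul0r cp_norm_ge0.
have ra : 0 < rnorm (a : K^o).
  rewrite lt_def rnorm_ge0 andbT; apply: contra_neq a0.
  exact: (@rnorm0_eq0 _ _ K^o).
rewrite mulrC -ler_pdivlMr//.
have {1}-> : f = a^-1 *: (a *: f) by rewrite scalerA mulVf// scale1r.
rewrite (le_trans (cp_normZ_le _ _))// mulrC ler_wpM2l ?cp_norm_ge0//.
have : rnorm (a^-1 : K^o) * rnorm (a : K^o) = 1.
  rewrite -(@rnormZ _ _ K^o) /GRing.scale/= mulVf//.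
  by apply: (@ofR_inj R k); rewrite -normE normr1 ofR1.
by move=> /(congr1 (fun u => u / rnorm (a : K^o))); rewrite mulfK ?gt_eqF// mul1r => ->.
Qed.

Lemma cp_norm_sup x f (M : R) w : 0 < M -> p_represents x f ->
  (lp_norm p x <= M%:E)%E -> rnorm (f w) <= M.
Proof.
move=> M0 [_ fx] /(lp_normP _ p1 (ltW M0)) xM.
have [a /(lp_normP _ q1 ler01) a1 ax] := fx (f w) (ex_intro2 _ _ w I erefl).
apply/ler_addgt0Pr => e e0.
have /cvg_rnormP /(_ e e0) [N _ /(_ N (leqnn N)) /= Ne] := ax.
rewrite -(subrK (series (fun n => (a n : K) *: x n) N) (f w)).
rewrite (le_trans (rnormD _ _))// addrC lerD//.
rewrite /series/= (le_trans (rnorm_sum _ _ _))//.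
under eq_bigr do rewrite rnormZ.
by apply: (lp_le_pairing N p1 _ _ M0 xM a1) => n; exact: rnorm_ge0.
Qed.

Lemma cpf_norm0_eq0 (f : cpf p1) : ofR k (cp_norm f) = 0 -> f = 0.
Proof.
rewrite -(ofR0 R k) => /ofR_inj f0; apply/val_inj/val_inj/funext => w /=.
apply/rnorm0_eq0/eqP; rewrite eq_le rnorm_ge0 andbT.
apply/ler_addgt0Pr => e e0; rewrite add0r.
have [x xf] := cp_norm_adherent (cpfP f) e0; rewrite f0 add0r => xe.
exact: cp_norm_sup e0 xf xe.
Qed.

HB.instance Definition _ := Lmodule_isNormed.Build K (cpf p1)
  cpf_normD cpf_normZ cpf_norm0_eq0.

Lemma cpf_rnormE (f : cpf p1) : rnorm f = cp_norm f.
Proof. exact: ofRK. Qed.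

Lemma tensor_represents (phi : scalar_contf R k Omega) (x : X) :
  exists2 y, p_represents y (tensor phi x) &
    (lp_norm p y <= (rnorm phi * rnorm x)%:E)%E.
Proof.
pose c := rnorm phi; have c0 : 0 <= c by exact: rnorm_ge0.
pose y n : X := if n is 0%N then ofR k c *: x else 0.
have rc : rnorm (ofR k c *: x) = c * rnorm x by rewrite rnormZ rnorm_ofR ger0_norm.
have yM : (lp_norm p y <= (c * rnorm x)%:E)%E.
  apply/lp_normP; rewrite ?mulr_ge0 ?rnorm_ge0//.
  case: (p) p1 => [r||//]; last first.
    by move=> _ [|n]; rewrite /y ?rc// rnorm0 mulr_ge0 ?rnorm_ge0.
  rewrite lee_fin => r1 [|N]; first by rewrite big_nil powR_ge0.
  rewrite big_nat_recl// big1 ?addr0 ?rc// => n _.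
  by rewrite rnorm0 powR0// gt_eqF// (lt_le_trans ltr01).
exists y => //; split.
  split; first exact: le_lt_trans yM (ltry _).
  move=> _; rewrite -(cvg_shiftS y); exact: cvg_cst.
move=> _ [w _ <-] /=.
pose a n : (K^o : normedModType K) := if n is 0%N then ofR k c^-1 * phi w else 0.
have phiw : rnorm (phi w) <= c.
  by rewrite /c contf_rnormE; apply: sup_norm_ub => //; exact: contf_bounded_on.
have ra n : rnorm (a n) <= 1.
  case: n => [|n] /=; last by rewrite rnorm0.
  rewrite (@rnormZ _ _ K^o) rnorm_ofR ger0_norm ?invr_ge0//.
  have [->|cn0] := eqVneq c 0; first by rewrite invr0 mul0r.
  by rewrite mulrC ler_pdivrMr ?mul1r// lt_def cn0.
exists a.
  apply/lp_normP => //; case: (hoelder_conjugate p) q1 => [r||//] //.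
  rewrite lee_fin => r1 [|N]; first by rewrite big_nil powR_ge0.
  rewrite big_nat_recl// big1 ?addr0 => [|n _]; last first.
    by rewrite rnorm0 powR0// gt_eqF// (lt_le_trans ltr01).
  apply: ge0_ler_powR; rewrite ?nnegrE ?rnorm_ge0//.
  exact: le_trans ler01 r1.
rewrite -(cvg_shiftS (series _)) (_ : (fun n => _) = cst (phi w *: x)).
  exact: cvg_cst.
apply/funext => N; rewrite /series/= big_nat_recl// big1 ?addr0; last first.
  by move=> n _; rewrite scaler0.
rewrite scalerA /a /=; have [cE|cn0] := eqVneq c 0.
  have -> : phi w = 0.
    by apply/rnorm0_eq0/eqP; rewrite eq_le rnorm_ge0 andbT -cE.
  by rewrite mulr0 mul0r.
by rewrite mulrAC -ofRM mulVf// ofR1 mul1r.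
Qed.

Lemma tensor_p_continuous (phi : scalar_contf R k Omega) (x : X) :
  tensor phi x \in p_continuous_pred.
Proof. by have [y yf _] := tensor_represents phi x; apply/asboolP; exists y. Qed.

Definition cp_tensor (phi : scalar_contf R k Omega) (x : X) : cpf p1 :=
  Cpf p1 (tensor_p_continuous phi x).

End PContinuousFunctions.

Section VectorMeasures.
Variables (R : realType) (k : scalar_kind).
Notation K := (scalar_field R k).
Variable Omega : compactHausdorffType.

Definition borel_sets : set (set Omega) := <<s [set A : set Omega | open A] >>.

Definition borel_simple (s : Omega -> K) : Prop :=
  finite_set (range s) /\ forall c, borel_sets (s @^-1` [set c]).

Variable Z : normedModType K.

(* Only the values of m on Borel sets are relevant. *)
Definition vector_measure (m : set Omega -> Z) : Prop :=
  forall A B, borel_sets A -> borel_sets B -> A `&` B = set0 ->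
    m (A `|` B) = m A + m B.

Definition bounded_measure (m : set Omega -> Z) : Prop :=
  exists M : R, forall A, borel_sets A -> rnorm (m A) <= M.

Definition simple_integral (m : set Omega -> Z) (s : Omega -> K) : Z :=
  \sum_(c \in range s) c *: m (s @^-1` [set c]).

(* The limit of the integrals of any sequence of simple functions converging
   uniformly to phi; for a bounded vector measure m with values in a complete
   space, this exists and is unique for every uniform limit phi of simple
   functions. *)
Definition is_vintegral (m : set Omega -> Z) (phi : Omega -> K) (z : Z) : Prop :=
  exists2 s : nat -> Omega -> K, (forall n, borel_simple (s n)) &
    {uniform, s @ \oo --> phi} /\
    simple_integral m (s n) @[n --> \oo] --> z.

Definition vintegral (m : set Omega -> Z) (phi : Omega -> K) : Z :=
  get (is_vintegral m phi).

End VectorMeasures.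

(* summing_norm q T is the norm of T in the ideal of absolutely q-summing
   operators, +oo if T is not in it; for q = +oo it is the operator norm. *)
Section SummingNorm.
Variables (R : realType) (k : scalar_kind).
Notation K := (scalar_field R k).
Variables V W : normedModType K.

Definition weak_sum (q : R) (n : nat) (v : 'I_n -> V) : R :=
  sup [set (\sum_(i < n) rnorm (f (v i) : (K^o : normedModType K)) `^ q) `^ q^-1
      | f in closed_unit_ball (dual_space V)].

Definition summing_constant (q : R) (T : V -> W) (C : R) : Prop :=
  0 <= C /\ forall n (v : 'I_n -> V),
    (\sum_(i < n) rnorm (T (v i)) `^ q) `^ q^-1 <= C * weak_sum q v.

Definition operator_bound (T : V -> W) (C : R) : Prop :=
  0 <= C /\ forall v, rnorm (T v) <= C * rnorm v.

Definition summing_norm (q : \bar R) (T : V -> W) : \bar R :=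
  match q with
  | r%:E => ereal_inf [set C%:E | C in summing_constant r T]
  | +oo%E => ereal_inf [set C%:E | C in operator_bound T]
  | -oo%E => +oo%E
  end.

End SummingNorm.

Section RepresentingMeasures.
Variables (R : realType) (k : scalar_kind).
Notation K := (scalar_field R k).
Variables (Omega : compactHausdorffType) (X Y : normedModType K).
Notation C_Omega := (scalar_contf R k Omega).
Implicit Type m : set Omega -> bddop X (bidual_space Y).

(* <x, m_y (E)> = <y, m(E) x> *)
Definition measure_at m (y : dual_space Y) : set Omega -> dual_space X :=
  fun E => comp_op (bidual_embed y) (m E).

Definition I_at m (y : dual_space Y) : C_Omega -> dual_space X :=
  fun phi => vintegral (measure_at m y) phi.

Definition semivariation (q : \bar R) m : \bar R :=
  ereal_sup [set summing_norm q (I_at m y)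
    | y in closed_unit_ball (dual_space Y)].

Definition bounded_semivariation (q : \bar R) m : Prop :=
  bounded_measure m /\ (semivariation q m < +oo)%E.

Definition represents m (S : bddop C_Omega (bddop X Y)) : Prop :=
  [/\ vector_measure m, bounded_measure m &
    forall phi : C_Omega, comp_op (bidual_map Y) (S phi) = vintegral m phi].

Variables (p : \bar R) (p1 : (1 <= p)%E).

(* J is f |-> int f dm.  There is at most one such J, since the functions
   phi x span a dense subspace. *)
Definition is_cp_integral m (J : bddop (cpf Omega X p1) (bidual_space Y)) :=
  forall (phi : C_Omega) (x : X), J (cp_tensor p1 phi x) = vintegral m phi x.

Definition cp_represents m (U : bddop (cpf Omega X p1) Y) : Prop :=
  [/\ vector_measure m,
    bounded_semivariation (hoelder_conjugate p) m &
    exists2 J, is_cp_integral m J & forall f, bidual_embed (U f) = J f].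

End RepresentingMeasures.

(* Main.v *)
Require Import Defs.
From mathcomp Require Import all_boot all_order all_algebra.
From mathcomp Require Import all_classical all_reals all_analysis.

Set Implicit Arguments.
Unset Strict Implicit.
Unset Printing Implicit Defensive.
Import Order.TTheory GRing.Theory Num.Theory.
Import numFieldNormedType.Exports.
Local Open Scope classical_set_scope.
Local Open Scope ring_scope.

(** The associated operator sends [phi] to the operator [x |-> U (phi x)].  It is
    well defined and bounded because the elementary functions [phi x] depend
    bilinearly on [phi] and [x] and have norm at most [|phi| |x|] in
    [C_p(Omega, X)].  On elementary functions the integral that represents [U] is
    [(int phi dm) x] by definition, so evaluating [U f = int f dm] at [f = phi x]
    says that [int phi dm] and [U# phi], the latter viewed as an operator into
    [Y**], agree at every [x].  Additivity and boundedness of [m] are part of its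
    being a representing measure of [U]. *)

Section ElementaryFunctions.
Variables (R : realType) (k : scalar_kind).
Variables (Omega : compactHausdorffType) (X : normedModType (scalar_field R k)).
Variables (p : \bar R) (p1 : (1 <= p)%E).
Implicit Types (phi : scalar_contf R k Omega) (x : X).

Lemma cp_tensor_linearl x : linear (fun phi => cp_tensor p1 phi x).
Proof.
move=> a phi psi; apply/val_inj/val_inj/funext => w /=.
by rewrite scalerDl -scalerA.
Qed.

Lemma cp_tensor_linearr phi : linear (cp_tensor p1 phi : X -> _).
Proof.
move=> a x z; apply/val_inj/val_inj/funext => w /=.
by rewrite scalerDr scalerA mulrC -scalerA.
Qed.

(** The values of [phi x] lie in the multiples of the single vector [|phi| x] by
    scalars of modulus at most 1, so the sequence [(|phi| x, 0, 0, ...)], whose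
    [l_p] norm is [|phi| |x|] for every [p], competes in the infimum that defines
    the norm of [phi x]. *)
Lemma rnorm_cp_tensor_le phi x : rnorm (cp_tensor p1 phi x) <= rnorm phi * rnorm x.
Proof.
have [y yf yM] := tensor_represents p1 phi x.
by rewrite cpf_rnormE; apply: cp_norm_le yf yM => //; rewrite mulr_ge0 ?rnorm_ge0.
Qed.

End ElementaryFunctions.

Section AssociatedOperator.
Variables (R : realType) (k : scalar_kind).
Variables (Omega : compactHausdorffType) (X Y : normedModType (scalar_field R k)).
Variables (p : \bar R) (p1 : (1 <= p)%E) (U : bddop (cpf Omega X p1) Y).
Implicit Types (phi : scalar_contf R k Omega) (x : X).

Lemma rnorm_op_cp_tensor_le phi x :
  rnorm (U (cp_tensor p1 phi x)) <= op_norm U * rnorm phi * rnorm x.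
Proof.
rewrite (le_trans (op_norm_bound _ _))// -mulrA.
by rewrite ler_wpM2l ?op_norm_ge0 ?rnorm_cp_tensor_le.
Qed.

Lemma associated_at_linear phi : linear (fun x => U (cp_tensor p1 phi x)).
Proof. by move=> a x z; rewrite cp_tensor_linearr linearP. Qed.

Lemma associated_at_bounded phi : exists M : R,
  forall x, rnorm (U (cp_tensor p1 phi x)) <= M * rnorm x.
Proof. by exists (op_norm U * rnorm phi) => x; exact: rnorm_op_cp_tensor_le. Qed.

Definition associated_at phi : bddop X Y :=
  mk_bddop (associated_at_linear phi) (associated_at_bounded phi).

Lemma associated_linear : linear associated_at.
Proof.
move=> a phi psi; apply/val_inj/funext => x /=.
by rewrite cp_tensor_linearl linearP.
Qed.

Lemma associated_bounded : exists M : R,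
  forall phi, rnorm (associated_at phi) <= M * rnorm phi.
Proof.
exists (op_norm U) => phi; rewrite rnormE; apply: sup_norm_le => [|x x1].
  by rewrite mulr_ge0 ?op_norm_ge0 ?rnorm_ge0.
rewrite (le_trans (rnorm_op_cp_tensor_le phi x))// ler_piMr//.
by rewrite mulr_ge0 ?op_norm_ge0 ?rnorm_ge0.
Qed.

Definition associated_operator : bddop (scalar_contf R k Omega) (bddop X Y) :=
  mk_bddop associated_linear associated_bounded.

End AssociatedOperator.

Theorem proposition4p4 (R : realType) (k : scalar_kind)
    (X Y : completeNormedModType (scalar_field R k))
    (Omega : compactHausdorffType) (p : \bar R) (p1 : (1 <= p)%E)
    (m : set Omega -> bddop X (bidual_space Y))
    (U : bddop (cpf Omega X p1) Y) :
  cp_represents m U ->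
  exists2 Usharp : bddop (scalar_contf R k Omega) (bddop X Y),
    (forall phi x, Usharp phi x = U (cp_tensor p1 phi x)) &
    represents m Usharp.
Proof.
move=> [madd [mbdd _] [J Jm UJ]]; exists (associated_operator U) => //.
split=> // phi; apply/val_inj/funext => x.
(* Both sides are operators into the bidual; at [x] the left one is the canonical
   image of [U (phi x)]. *)
by rewrite -[RHS]Jm -UJ.
Qed.
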